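(* Let $A$ be a commutative Noetherian $\mathbb{C}$-algebra that is a domain and let $\delta$ be a non-zero derivation of $A$. Let $R=A[z;\delta]$ be the Ore extension and let $B$ be the Poisson algebra $A[z]$ (commutative polynomial algebra) with the Poisson bracket $\{-,-\}_{\delta}$. Then there is a homeomorphism between $\operatorname{Spec} R$ and $\operatorname{P.Spec} B$.
   Context: Derivations are $\mathbb{C}$-linear. The Ore extension $A[z;\delta]$ consists of elements $\sum_{i=0}^n a_iz^i$ with $a_i\in A$, with multiplication determined by $za-az=\delta(a)$ for all $a\in A$. A Poisson algebra is a commutative $\mathbb{C}$-algebra $B$ with a bilinear product $\{-,-\}:B\times B\to B$ making $B$ a Lie algebra and such that, for each $b\in B$, the map $\{b,-\}$ is a $\mathbb{C}$-derivation of $B$. The bracket $\{-,-\}_\delta$ on the polynomial algebra $A[z]$ is the Poisson bracket determined by $\{a,b\}_\delta=0$ and $\{z,a\}_\delta=\delta(a)$ for all $a,b\in A$. An ideal $I$ of a Poisson algebra $B$ is a Poisson ideal if $\{i,b\}\in I$ for all $i\in I$, $b\in B$. A proper Poisson ideal $P$ is Poisson prime if, for all Poisson ideals $I,J$ of $B$, $IJ\subseteq P$ implies $I\subseteq P$ or $J\subseteq P$. (When $B$ is Noetherian, every Poisson prime ideal is a prime ideal.) $\operatorname{Spec} R$ is the set of prime (two-sided) ideals of the not necessarily commutative ring $R$ with the Zariski topology, whose closed sets are $\{P\in\operatorname{Spec}R: P\supseteq I\}$ for ideals $I$ of $R$. $\operatorname{P.Spec}B$ is the set of Poisson prime ideals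 of $B$ with the topology induced from the Zariski topology on $\operatorname{Spec}B$, i.e. closed sets are $\{P\in \operatorname{P.Spec}B:P\supseteq I\}$ for ideals $I$ of $B$. *)

(* Defs.v *)
From HB Require Import structures.
From mathcomp Require Import all_boot all_order all_algebra.
From mathcomp Require Import ring.
From mathcomp Require Import boolp classical_sets reals topology.
From mathcomp Require Import complex.

Set Implicit Arguments.
Unset Strict Implicit.
Unset Printing Implicit Defensive.

Import GRing.Theory.
Local Open Scope classical_set_scope.
Local Open Scope ring_scope.

Section Ideals.
Variable R : nzRingType.
Implicit Types I J P : set R.

Record is_ideal I : Prop := IsIdeal {
  ideal0 : I 0;
  idealD : forall x y, I x -> I y -> I (x + y);
  idealMl : forall a x, I x -> I (a * x);
  idealMr : forall a x, I x -> I (x * a) }.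

Definition ideal_mul I J : set R :=
  [set x | exists s : seq (R * R),
     (forall p, p \in s -> I p.1 /\ J p.2) /\ x = \sum_(p <- s) p.1 * p.2].

Record prime_ideal P : Prop := PrimeIdeal {
  prime_is_ideal : is_ideal P;
  prime_proper : P <> setT;
  primeM : forall I J, is_ideal I -> is_ideal J ->
    ideal_mul I J `<=` P -> I `<=` P \/ J `<=` P }.

Definition noetherian : Prop :=
  forall I : nat -> set R,
    (forall n, is_ideal (I n)) -> (forall n, I n `<=` I n.+1) ->
    exists N, forall n, (N <= n)%N -> I n = I N.

Lemma is_idealT : is_ideal setT. Proof. by split. Qed.

Lemma is_idealI I J : is_ideal I -> is_ideal J -> is_ideal (I `&` J).
Proof.
move=> hI hJ; split=> [|x y [Ix Jx] [Iy Jy]|a x [Ix Jx]|a x [Ix Jx]].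
- by split; exact: ideal0.
- by split; apply: idealD.
- by split; apply: idealMl.
- by split; apply: idealMr.
Qed.

Definition ideal_gen (S : set R) : set R :=
  [set x | forall I, is_ideal I -> S `<=` I -> I x].

Lemma is_ideal_gen S : is_ideal (ideal_gen S).
Proof.
split=> [I hI _|x y hx hy I hI SI|a x hx I hI SI|a x hx I hI SI].
- exact: ideal0.
- by apply: idealD => //; [apply: hx|apply: hy].
- by apply: idealMl => //; apply: hx.
- by apply: idealMr => //; apply: hx.
Qed.

Lemma sub_ideal_gen S : S `<=` ideal_gen S.
Proof. by move=> x Sx I _; apply. Qed.

Lemma ideal_gen_sub S I : is_ideal I -> S `<=` I -> ideal_gen S `<=` I.
Proof. by move=> hI SI x; apply. Qed.

Lemma ideal_mul_subI I J : is_ideal I -> is_ideal J ->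
  ideal_mul I J `<=` I `&` J.
Proof.
move=> hI hJ _ [s [hs ->]]; elim: s hs => [|p s IHs] hs.
  by rewrite big_nil; split; exact: ideal0.
rewrite big_cons; have [Ip Jp] := hs p (mem_head _ _).
have [] := IHs (fun q qs => hs q (@mem_behead _ (p :: s) q qs)).
move=> Is Js; split; apply: idealD => //; first exact: idealMr.
exact: idealMl.
Qed.

End Ideals.

Record Spec (R : nzRingType) := MkSpec {
  spec_ideal :> set R;
  spec_prime : prime_ideal spec_ideal }.

HB.instance Definition _ (R : nzRingType) := gen_eqMixin (Spec R).
HB.instance Definition _ (R : nzRingType) := gen_choiceMixin (Spec R).

Section ZariskiSpec.
Variable R : nzRingType.

Definition spec_V (I : set R) : set (Spec R) := [set P : Spec R | I `<=` P].

Definition spec_open (U : set (Spec R)) : Prop :=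
  exists2 I : set R, is_ideal I & ~` U = spec_V I.

Let spec_openT : spec_open setT.
Proof.
exists setT; first exact: is_idealT.
rewrite setCT; apply/seteqP; split=> // P TP.
by case: (prime_proper (spec_prime P)); apply/seteqP; split.
Qed.

Let spec_openI : setI_closed spec_open.
Proof.
move=> U W [I hI UI] [J hJ WJ]; exists (I `&` J); first exact: is_idealI.
rewrite setCI UI WJ; apply/seteqP; split=> P /=.
  by case=> sub x [Ix Jx]; apply: sub.
move=> sub; apply: (primeM (spec_prime P)) => //.
exact: subset_trans (ideal_mul_subI hI hJ) sub.
Qed.

Let spec_open_bigcup (T : Type) (U : T -> set (Spec R)) :
  (forall i, spec_open (U i)) -> spec_open (\bigcup_i U i).
Proof.
move=> hU; pose S : set R :=
  [set x | exists i I, [/\ is_ideal I, ~` U i = spec_V I & I x]].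
exists (ideal_gen S); first exact: is_ideal_gen.
apply/seteqP; split=> P /=.
  move=> nUP; apply: ideal_gen_sub; first exact: prime_is_ideal (spec_prime P).
  move=> x [i [I [_ UI Ix]]]; have : spec_V I P.
    by rewrite -UI => UiP; apply: nUP; exists i.
  exact.
move=> sub [i _ UiP]; have [I hI UI] := hU i.
suff : (~` U i) P by apply.
rewrite UI => x Ix; apply: sub; apply: sub_ideal_gen.
by exists i, I.
Qed.

HB.instance Definition _ := isOpenTopological.Build (Spec R)
  spec_openT spec_openI spec_open_bigcup.

Lemma spec_closedP (F : set (Spec R)) :
  closed F <-> exists2 I : set R, is_ideal I & F = spec_V I.
Proof. by rewrite -openC; split=> -[I hI]; rewrite ?setCK => ?; exists I; rewrite ?setCK. Qed.

End ZariskiSpec.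

HB.mixin Record isPoisson (k : comNzRingType) B & GRing.ComAlgebra k B := {
  bracket : B -> B -> B;
  bracket_linearl : forall (c : k) x y w,
    bracket (c *: x + y) w = c *: bracket x w + bracket y w;
  bracket_linearr : forall (c : k) w x y,
    bracket w (c *: x + y) = c *: bracket w x + bracket w y;
  bracket_alt : forall x, bracket x x = 0;
  bracket_jacobi : forall x y w,
    bracket x (bracket y w) + bracket y (bracket w x) +
    bracket w (bracket x y) = 0;
  bracket_leibniz : forall b x y,
    bracket b (x * y) = bracket b x * y + x * bracket b y }.

#[short(type="poissonAlgType")]
HB.structure Definition PoissonAlg (k : comNzRingType) :=
  { B of isPoisson k B & GRing.ComAlgebra k B }.

Section PoissonIdeals.
Variables (k : comNzRingType) (B : poissonAlgType k).
Implicit Types I J P : set B.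

Definition poisson_ideal I : Prop :=
  is_ideal I /\ forall i b, I i -> I (bracket i b).

Record poisson_prime P : Prop := PoissonPrime {
  poisson_prime_is_ideal : poisson_ideal P;
  poisson_prime_proper : P <> setT;
  poisson_primeM : forall I J, poisson_ideal I -> poisson_ideal J ->
    ideal_mul I J `<=` P -> I `<=` P \/ J `<=` P }.

Lemma poisson_idealT : poisson_ideal setT.
Proof. by split; first exact: is_idealT. Qed.

Lemma poisson_idealI I J :
  poisson_ideal I -> poisson_ideal J -> poisson_ideal (I `&` J).
Proof.
move=> [hI pI] [hJ pJ]; split; first exact: is_idealI.
by move=> i b [Ii Ji]; split; [exact: pI|exact: pJ].
Qed.

Definition poisson_ideal_gen (S : set B) : set B :=
  [set x | forall I, poisson_ideal I -> S `<=` I -> I x].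

Lemma poisson_ideal_gen_ideal S : poisson_ideal (poisson_ideal_gen S).
Proof.
split; last by move=> i b hi I hI SI; apply: hI.2; apply: hi.
split=> [I [hI _] _|x y hx hy I hI SI|a x hx I hI SI|a x hx I hI SI].
- exact: ideal0.
- by apply: (idealD hI.1); [apply: hx|apply: hy].
- by apply: (idealMl hI.1); apply: hx.
- by apply: (idealMr hI.1); apply: hx.
Qed.

Lemma sub_poisson_ideal_gen S : S `<=` poisson_ideal_gen S.
Proof. by move=> x Sx I _; apply. Qed.

Lemma poisson_ideal_gen_sub S I :
  poisson_ideal I -> S `<=` I -> poisson_ideal_gen S `<=` I.
Proof. by move=> hI SI x; apply. Qed.

End PoissonIdeals.

Record PSpec (k : comNzRingType) (B : poissonAlgType k) := MkPSpec {
  pspec_ideal :> set B;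
  pspec_prime : poisson_prime pspec_ideal }.

HB.instance Definition _ (k : comNzRingType) (B : poissonAlgType k) :=
  gen_eqMixin (PSpec B).
HB.instance Definition _ (k : comNzRingType) (B : poissonAlgType k) :=
  gen_choiceMixin (PSpec B).

Section ZariskiPSpec.
Variables (k : comNzRingType) (B : poissonAlgType k).

Definition pspec_V (I : set B) : set (PSpec B) := [set P : PSpec B | I `<=` P].

Definition pspec_open (U : set (PSpec B)) : Prop :=
  exists2 I : set B, is_ideal I & ~` U = pspec_V I.

Let pspec_V_gen (I : set B) : pspec_V (poisson_ideal_gen I) = pspec_V I.
Proof.
apply/seteqP; split=> P /=.
  exact: subset_trans (@sub_poisson_ideal_gen _ _ _).
exact: poisson_ideal_gen_sub (poisson_prime_is_ideal (pspec_prime P)).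
Qed.

Let pspec_openT : pspec_open setT.
Proof.
exists setT; first exact: is_idealT.
rewrite setCT; apply/seteqP; split=> // P TP.
by case: (poisson_prime_proper (pspec_prime P)); apply/seteqP; split.
Qed.

Let pspec_openI : setI_closed pspec_open.
Proof.
move=> U W [I hI UI] [J hJ WJ].
have hI' := poisson_ideal_gen_ideal I; have hJ' := poisson_ideal_gen_ideal J.
exists (poisson_ideal_gen I `&` poisson_ideal_gen J).
  by have [] := poisson_idealI hI' hJ'.
rewrite setCI UI WJ -(pspec_V_gen I) -(pspec_V_gen J).
apply/seteqP; split=> P /=; first by case=> sub x [Ix Jx]; apply: sub.
move=> sub; apply: (poisson_primeM (pspec_prime P)) => //.
exact: subset_trans (ideal_mul_subI hI'.1 hJ'.1) sub.
Qed.

Let pspec_open_bigcup (T : Type) (U : T -> set (PSpec B)) :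
  (forall i, pspec_open (U i)) -> pspec_open (\bigcup_i U i).
Proof.
move=> hU; pose S : set B :=
  [set x | exists i I, [/\ is_ideal I, ~` U i = pspec_V I & I x]].
exists (ideal_gen S); first exact: is_ideal_gen.
apply/seteqP; split=> P /=.
  move=> nUP; apply: ideal_gen_sub.
    exact: (poisson_prime_is_ideal (pspec_prime P)).1.
  move=> x [i [I [_ UI Ix]]]; have : pspec_V I P.
    by rewrite -UI => UiP; apply: nUP; exists i.
  exact.
move=> sub [i _ UiP]; have [I hI UI] := hU i.
suff : (~` U i) P by apply.
rewrite UI => x Ix; apply: sub; apply: sub_ideal_gen.
by exists i, I.
Qed.

HB.instance Definition _ := isOpenTopological.Build (PSpec B)
  pspec_openT pspec_openI pspec_open_bigcup.

Lemma pspec_closedP (F : set (PSpec B)) :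
  closed F <-> exists2 I : set B, is_ideal I & F = pspec_V I.
Proof. by rewrite -openC; split=> -[I hI]; rewrite ?setCK => ?; exists I; rewrite ?setCK. Qed.

End ZariskiPSpec.

Definition homeomorphic (S T : topologicalType) : Prop :=
  exists (f : S -> T) (g : T -> S),
    [/\ cancel f g, cancel g f, continuous f & continuous g].

Record derivation (k : comNzRingType) (A : comAlgType k) := Derivation {
  der_fun :> {linear A -> A};
  der_leibniz : forall a b, der_fun (a * b) = der_fun a * b + a * der_fun b }.

Section DerivationTheory.
Variables (k : comNzRingType) (A : comAlgType k) (delta : derivation A).

Lemma der1 : delta 1 = 0.
Proof.
have /eqP := der_leibniz delta 1 1.
by rewrite !mulr1 mul1r eq_sym -subr_eq0 addrK => /eqP.
Qed.

Definition der_coef (p : {poly A}) : {poly A} := map_poly delta p.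

Lemma coef_der_coef p i : (der_coef p)`_i = delta p`_i.
Proof. by rewrite coef_map. Qed.

Lemma der_coefD p q : der_coef (p + q) = der_coef p + der_coef q.
Proof. exact: raddfD. Qed.

Lemma der_coefC a : der_coef a%:P = (delta a)%:P.
Proof. exact: map_polyC. Qed.

Lemma der_coefX : der_coef 'X = 0.
Proof.
by apply/polyP => i; rewrite coef_der_coef coefX coef0; case: eqP;
  rewrite ?der1 ?raddf0.
Qed.

Lemma der_coefM p q : der_coef (p * q) = der_coef p * q + p * der_coef q.
Proof.
apply/polyP => i; rewrite coefD coef_der_coef !coefM raddf_sum -big_split /=.
by apply: eq_bigr => j _; rewrite der_leibniz !coef_der_coef.
Qed.

Lemma der_coefZ a p : der_coef (a *: p) = delta a *: p + a *: der_coef p.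
Proof. by rewrite -!mul_polyC der_coefM der_coefC. Qed.

Lemma der_coef_deriv p : der_coef p^`() = (der_coef p)^`().
Proof.
by apply/polyP => i; rewrite coef_deriv !coef_der_coef coef_deriv raddfMn.
Qed.

End DerivationTheory.

(* The underlying additive group is that of {poly A}, the polynomial
   \sum_i a_i 'X^i standing for \sum_i a_i z^i. *)
Definition ore_ext (k : comNzRingType) (A : comAlgType k)
  (delta : derivation A) : Type := {poly A}.

HB.instance Definition _ (k : comNzRingType) (A : comAlgType k)
  (delta : derivation A) := GRing.Zmodule.on (ore_ext delta).

Section OreExtension.
Variables (k : comNzRingType) (A : comAlgType k) (delta : derivation A).
Implicit Types p q r : {poly A}.

(* Left multiplication by z: z (\sum_i b_i z^i) =
   \sum_i b_i z^(i+1) + \sum_i delta(b_i) z^i. *)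
Definition ore_zmul p : {poly A} := p * 'X + der_coef delta p.

Definition ore_mul p q : {poly A} := \sum_(i < size p) p`_i *: iter i ore_zmul q.

Let zmul0 : ore_zmul 0 = 0.
Proof. by rewrite /ore_zmul mul0r /der_coef map_poly0 addr0. Qed.

Let zmulD p q : ore_zmul (p + q) = ore_zmul p + ore_zmul q.
Proof. by rewrite /ore_zmul mulrDl der_coefD addrACA. Qed.

Let zmulZ a p : ore_zmul (a *: p) = a *: ore_zmul p + delta a *: p.
Proof. by rewrite /ore_zmul -scalerAl der_coefZ scalerDr -addrA (addrC (_ *: p)). Qed.

Let zmul_sum n (F : 'I_n -> {poly A}) :
  ore_zmul (\sum_i F i) = \sum_i ore_zmul (F i).
Proof. exact: (big_morph ore_zmul zmulD zmul0). Qed.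

Let iterD i p q : iter i ore_zmul (p + q) = iter i ore_zmul p + iter i ore_zmul q.
Proof. by elim: i => //= i ->; rewrite zmulD. Qed.

Let mul_wide n p q : (size p <= n)%N ->
  ore_mul p q = \sum_(i < n) p`_i *: iter i ore_zmul q.
Proof.
move=> le_pn; rewrite /ore_mul (big_ord_widen n (fun i => p`_i *: iter i ore_zmul q)) //.
rewrite big_mkcond; apply: eq_bigr => i _ /=; case: ltnP => // le_pi.
by rewrite nth_default // scale0r.
Qed.

Let mulDl : left_distributive ore_mul +%R.
Proof.
move=> p q r; set n := maxn (size p) (size q).
rewrite (@mul_wide n (p + q)) ?size_polyD // (@mul_wide n p) ?leq_maxl //.
rewrite (@mul_wide n q) ?leq_maxr // -big_split /=.
by apply: eq_bigr => i _; rewrite coefD scalerDl.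
Qed.

Let mulDr : right_distributive ore_mul +%R.
Proof.
move=> p q r; rewrite -big_split /=.
by apply: eq_bigr => i _; rewrite iterD scalerDr.
Qed.

Let mul0p q : ore_mul 0 q = 0.
Proof. by rewrite /ore_mul size_poly0 big_ord0. Qed.

Let mulZ a p q : ore_mul (a *: p) q = a *: ore_mul p q.
Proof.
rewrite (@mul_wide (size p)) ?size_scale_leq // scaler_sumr.
by apply: eq_bigr => i _; rewrite coefZ scalerA.
Qed.

Let mulzl p q : ore_mul (ore_zmul p) q = ore_zmul (ore_mul p q).
Proof.
rewrite {2}/ore_mul zmul_sum.
under eq_bigr => i _ do rewrite zmulZ.
rewrite big_split /= /ore_zmul mulDl; congr (_ + _).
  rewrite (@mul_wide (size p).+1); last first.
    by apply: leq_trans (size_polyMleq _ _) _; rewrite size_polyX addn2.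
  rewrite big_ord_recl /= coefMX eqxx scale0r add0r.
  by apply: eq_bigr => i _; rewrite coefMX.
rewrite (@mul_wide (size p)); last exact: size_poly.
by apply: eq_bigr => i _; rewrite coef_der_coef.
Qed.

Let mulA : associative ore_mul.
Proof.
move=> p q r; rewrite {1 4}/ore_mul.
rewrite (big_morph (ore_mul^~ r) (fun x y => mulDl x y r) (mul0p r)).
apply: eq_bigr => i _; rewrite mulZ; congr (_ *: _).
by elim: (nat_of_ord i) => //= m ->; rewrite mulzl.
Qed.

Let mulCp a q : ore_mul a%:P q = a *: q.
Proof.
by rewrite (@mul_wide 1) ?size_polyC ?leq_b1 // big_ord1 coefC.
Qed.

Let mul1p : left_id 1 ore_mul.
Proof. by move=> q; rewrite mulCp scale1r. Qed.

Let iter_z1 i : iter i ore_zmul 1 = 'X^i.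
Proof.
elim: i => [|i IHi] /=; first by rewrite expr0.
rewrite IHi /ore_zmul exprSr -[RHS]addr0; congr (_ + _).
by apply/polyP => j; rewrite coef_der_coef coefXn coef0; case: eqP;
  rewrite ?der1 ?raddf0.
Qed.

Let mulp1 : right_id 1 ore_mul.
Proof.
move=> p; rewrite /ore_mul -[RHS]coefK poly_def.
by apply: eq_bigr => i _; rewrite iter_z1.
Qed.

HB.instance Definition _ := GRing.Zmodule_isNzRing.Build (ore_ext delta)
  mulA mul1p mulp1 mulDl mulDr (oner_neq0 {poly A}).

Definition oreC (a : A) : ore_ext delta := a%:P.
Definition oreZ : ore_ext delta := 'X : {poly A}.

Lemma oreC_zmod : zmod_morphism oreC.
Proof. by move=> a b; exact: (polyCB a b). Qed.

Lemma oreC_monoid : monoid_morphism oreC.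
Proof.
split=> // a b; rewrite [RHS](_ : _ = ore_mul a%:P b%:P) // mulCp.
by rewrite -mul_polyC -polyCM.
Qed.

HB.instance Definition _ := GRing.isZmodMorphism.Build A (ore_ext delta) oreC
  oreC_zmod.
HB.instance Definition _ := GRing.isMonoidMorphism.Build A (ore_ext delta) oreC
  oreC_monoid.

Lemma ore_commutation a : oreZ * oreC a - oreC a * oreZ = oreC (delta a).
Proof.
rewrite [oreZ * _](_ : _ = ore_zmul a%:P); last first.
  have -> : oreZ * oreC a = ore_mul 'X a%:P by [].
  rewrite (@mul_wide 2) ?size_polyX // big_ord_recl big_ord1 /= !coefX /=.
  by rewrite scale0r add0r scale1r.
rewrite [_ * oreZ](_ : _ = a *: 'X); last exact: mulCp.
by rewrite /ore_zmul mul_polyC der_coefC [LHS]addrAC subrr add0r.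
Qed.

Lemma ore_expansion (p : ore_ext delta) :
  p = \sum_(i < size (p : {poly A})) oreC (p : {poly A})`_i * oreZ ^+ i.
Proof.
rewrite -{1}[p]coefK poly_def; apply: eq_bigr => i _.
have -> : oreZ ^+ i = 'X^i :> {poly A}.
  rewrite -iter_z1; elim: (nat_of_ord i) => // m IHm; rewrite exprS /= -IHm.
  have -> : oreZ * oreZ ^+ m = ore_mul 'X (oreZ ^+ m : ore_ext delta) by [].
  rewrite (@mul_wide 2) ?size_polyX // big_ord_recl big_ord1 /= !coefX /=.
  by rewrite scale0r add0r scale1r.
by rewrite -mulCp.
Qed.

End OreExtension.

Definition poisson_poly (k : comNzRingType) (A : comAlgType k)
  (delta : derivation A) : Type := {poly A}.

HB.instance Definition _ (k : comNzRingType) (A : comAlgType k)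
  (delta : derivation A) := GRing.ComNzRing.on (poisson_poly delta).

Section PoissonPolynomials.
Variables (k : comNzRingType) (A : comAlgType k) (delta : derivation A).
Implicit Types p q r : {poly A}.

(* The k-algebra structure on A[z]; {poly A} itself carries the one over A. *)
Definition ppoly_scale (c : k) p : {poly A} := c%:A *: p.

Let scaleA a b p : ppoly_scale a (ppoly_scale b p) = ppoly_scale (a * b) p.
Proof. by rewrite /ppoly_scale !scalerA -scalerAl mul1r scalerA. Qed.

Let scale1 : left_id 1 ppoly_scale.
Proof. by move=> p; rewrite /ppoly_scale !scale1r. Qed.

Let scaleDr : right_distributive ppoly_scale +%R.
Proof. by move=> a p q; rewrite /ppoly_scale scalerDr. Qed.

Let scaleDl p : {morph ppoly_scale^~ p : a b / a + b}.
Proof. by move=> a b; rewrite /ppoly_scale !scalerDl. Qed.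

HB.instance Definition _ := GRing.Zmodule_isLmodule.Build k (poisson_poly delta)
  scaleA scale1 scaleDr scaleDl.

Let scaleAl (c : k) (p q : poisson_poly delta) : c *: (p * q) = (c *: p) * q.
Proof. exact: (scalerAl (c%:A : A) (p : {poly A}) q). Qed.

HB.instance Definition _ := GRing.Lmodule_isLalgebra.Build k (poisson_poly delta)
  scaleAl.
HB.instance Definition _ :=
  GRing.Lalgebra_isComAlgebra.Build k (poisson_poly delta).

Definition ppoly_bracket p q : {poly A} :=
  p^`() * der_coef delta q - der_coef delta p * q^`().

Let der_scale c p : der_coef delta (ppoly_scale c p) =
  ppoly_scale c (der_coef delta p).
Proof.
by rewrite /ppoly_scale der_coefZ linearZ /= der1 scaler0 scale0r add0r.
Qed.

Let brZl c p q r : ppoly_bracket (ppoly_scale c p + q) r =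
  ppoly_scale c (ppoly_bracket p r) + ppoly_bracket q r.
Proof.
rewrite /ppoly_bracket !der_coefD der_scale derivD /ppoly_scale derivZ.
by rewrite -!mul_polyC; ring.
Qed.

Let bralt p : ppoly_bracket p p = 0.
Proof. by rewrite /ppoly_bracket; ring. Qed.

Let brZr c r p q : ppoly_bracket r (ppoly_scale c p + q) =
  ppoly_scale c (ppoly_bracket r p) + ppoly_bracket r q.
Proof.
rewrite /ppoly_bracket !der_coefD der_scale derivD /ppoly_scale derivZ.
by rewrite -!mul_polyC; ring.
Qed.

Let der_coefB p q : der_coef delta (p - q) = der_coef delta p - der_coef delta q.
Proof. exact: raddfB. Qed.

Let brjacobi p q r :
  ppoly_bracket p (ppoly_bracket q r) + ppoly_bracket q (ppoly_bracket r p) +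
  ppoly_bracket r (ppoly_bracket p q) = 0.
Proof.
rewrite /ppoly_bracket !der_coefB !derivB !der_coefM !derivM !der_coef_deriv.
ring.
Qed.

Let brleibniz p q r : ppoly_bracket p (q * r) =
  ppoly_bracket p q * r + q * ppoly_bracket p r.
Proof. by rewrite /ppoly_bracket der_coefM derivM; ring. Qed.

HB.instance Definition _ := isPoisson.Build k (poisson_poly delta)
  brZl brZr bralt brjacobi brleibniz.

Definition ppolyC (a : A) : poisson_poly delta := a%:P.
Definition ppolyZ : poisson_poly delta := 'X : {poly A}.

Lemma ppoly_bracketCC a b : bracket (ppolyC a) (ppolyC b) = 0.
Proof.
have -> : bracket (ppolyC a) (ppolyC b) = ppoly_bracket a%:P b%:P by [].
by rewrite /ppoly_bracket !derivC mul0r mulr0 subr0.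
Qed.

Lemma ppoly_bracketZC a : bracket ppolyZ (ppolyC a) = ppolyC (delta a).
Proof.
have -> : bracket ppolyZ (ppolyC a) = ppoly_bracket 'X a%:P by [].
by rewrite /ppoly_bracket derivX derivC mul1r mulr0 subr0 der_coefC.
Qed.

Lemma ppoly_bracket_unique (br : {poly A} -> {poly A} -> {poly A}) :
  (forall p q r, br (p + q) r = br p r + br q r) ->
  (forall p q r, br p (q + r) = br p q + br p r) ->
  (forall p, br p p = 0) ->
  (forall p q r, br p (q * r) = br p q * r + q * br p r) ->
  (forall a b, br a%:P b%:P = 0) ->
  (forall a, br 'X a%:P = (delta a)%:P) ->
  forall p q, br p q = ppoly_bracket p q.
Proof.
move=> brDl brDr br0 brM brCC brZC.
have brN p q : br p q = - br q p.
  apply/eqP; rewrite -addr_eq0; apply/eqP.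
  by have := br0 (p + q); rewrite brDl !brDr !br0 add0r addr0.
have bN p q : ppoly_bracket p q = - ppoly_bracket q p.
  by rewrite /ppoly_bracket; ring.
have bDr p q r : ppoly_bracket p (q + r) = ppoly_bracket p q + ppoly_bracket p r.
  by rewrite /ppoly_bracket der_coefD derivD; ring.
have gen p : (forall a, br p a%:P = ppoly_bracket p a%:P) ->
    br p 'X = ppoly_bracket p 'X -> forall q, br p q = ppoly_bracket p q.
  move=> hC hX; elim/poly_ind => [|q c IHq]; first by rewrite -polyC0 hC.
  by rewrite brDr brM bDr brleibniz IHq hX hC.
have hCC a b : br a%:P b%:P = ppoly_bracket a%:P b%:P.
  by rewrite brCC /ppoly_bracket !derivC mul0r mulr0 subr0.
have hZC a : br 'X a%:P = ppoly_bracket 'X a%:P.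
  by rewrite brZC /ppoly_bracket derivX derivC mul1r mulr0 subr0 der_coefC.
have hC a q : br a%:P q = ppoly_bracket a%:P q.
  by apply: gen => [b|]; [exact: hCC|rewrite brN bN hZC].
have hX q : br 'X q = ppoly_bracket 'X q.
  by apply: gen => //; rewrite br0 bralt.
move=> p; apply: gen => [a|]; first by rewrite brN bN hC.
by rewrite brN bN hX.
Qed.

End PoissonPolynomials.

(* Main.v *)
(* The spaces are identified by the identity on subsets of {poly A}, and closed
   sets are the sets {P | S <= P} with S an arbitrary subset, so it suffices
   that the primes of A[z; delta] and the Poisson primes of A[z] are the same
   subsets. If P contains delta(A), then modulo P both structures are those of
   the commutative ring A[z], and P is prime iff it is so there. Otherwise the
   contraction Q of P to A is delta-prime, hence prime (A is Noetherian of
   characteristic 0); if p in P has degree n then bracketing n times with c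
   gives n! p_n (delta c)^n in lowest degree, which forces P = Q[z]. Conversely
   such Q[z] are prime on both sides, by the same degree reduction. *)
Require Import Defs.
From HB Require Import structures.
From mathcomp Require Import all_boot all_order all_algebra.
From mathcomp Require Import ring.
From mathcomp Require Import boolp classical_sets reals topology.
From mathcomp Require Import complex.
Set Implicit Arguments.
Unset Strict Implicit.
Unset Printing Implicit Defensive.
Import GRing.Theory.
Local Open Scope ring_scope.

(** * Sums and products of two-sided ideals *)

Section IdealTheory.
Local Open Scope classical_set_scope.
Context {R : nzRingType}.
Implicit Types I J P : set R.

Lemma idealN I x : is_ideal I -> I x -> I (- x).
Proof. by move=> hI Ix; rewrite -mulN1r; apply: idealMl. Qed.

Lemma idealB I x y : is_ideal I -> I x -> I y -> I (x - y).
Proof. by move=> hI Ix Iy; apply: idealD => //; apply: idealN. Qed.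

Lemma ideal_sum I (T : Type) (r : seq T) (F : T -> R) :
  is_ideal I -> (forall i, I (F i)) -> I (\sum_(i <- r) F i).
Proof.
move=> hI IF; elim/big_ind: _ => //; first exact: ideal0.
by move=> x y; apply: idealD.
Qed.

Lemma ideal_mul_subP I J P : is_ideal P ->
  (ideal_mul I J `<=` P) <-> (forall x y, I x -> J y -> P (x * y)).
Proof.
move=> hP; split=> [sub x y Ix Jy|IJP _ [s [hs ->]]].
  apply: sub; exists [:: (x, y)]; rewrite big_seq1; split=> // p.
  by rewrite inE => /eqP ->.
rewrite big_seq; elim/big_ind: _ => //; first exact: ideal0.
  by move=> x y; apply: idealD.
by move=> p /hs [Ip Jp]; apply: IJP.
Qed.

Definition ideal_add I J : set R := [set x | exists2 u, I u & J (x - u)].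

Lemma is_ideal_add I J : is_ideal I -> is_ideal J -> is_ideal (ideal_add I J).
Proof.
move=> hI hJ; split=> [|x y [u Iu Jx] [v Iv Jy]|a x [u Iu Jx]|a x [u Iu Jx]].
- by exists 0; rewrite ?subr0; apply: ideal0.
- by exists (u + v); rewrite ?opprD 1?addrACA; apply: idealD.
- by exists (a * u); rewrite -?mulrBr; apply: idealMl.
- by exists (u * a); rewrite -?mulrBl; apply: Defs.idealMr.
Qed.

Lemma sub_ideal_addl I J : is_ideal J -> I `<=` ideal_add I J.
Proof. by move=> hJ x Ix; exists x => //; rewrite subrr; apply: ideal0. Qed.

Lemma sub_ideal_addr I J : is_ideal I -> J `<=` ideal_add I J.
Proof. by move=> hI x Jx; exists 0; rewrite ?subr0 //; apply: ideal0. Qed.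

Lemma ideal_add_sub I P : is_ideal P -> ideal_add I P `<=` P -> I `<=` P.
Proof. by move=> hP sub x Ix; apply: sub; apply: sub_ideal_addl. Qed.

End IdealTheory.

(** * Derivation-prime ideals of a commutative algebra in characteristic zero *)

Section DeltaPrime.
Local Open Scope classical_set_scope.
Context {k : numFieldType} {A : comAlgType k} (delta : derivation A).
Implicit Types (I J Q : set A) (a b c x y : A).

Definition der_stable Q : Prop := forall a, Q a -> Q (delta a).

(** Characteristic zero enters here: n + 1 is invertible in k. *)
Lemma natr_unit_ideal I n x : is_ideal I -> I (n.+1%:R * x) -> I x.
Proof.
move=> hI /(idealMl hI ((n.+1%:R^-1 : k)%:A)).
rewrite mulr_algl mulr_natl -(@scaler_nat k) scalerA.
by rewrite mulVf ?scale1r // Num.Theory.pnatr_eq0.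
Qed.

Lemma derXn x n : delta (x ^+ n.+1) = n.+1%:R * x ^+ n * delta x.
Proof.
elim: n => [|n IHn]; first by rewrite expr1 expr0 !mul1r.
by rewrite exprS der_leibniz IHn exprS; ring.
Qed.

(** The extra factor x avoids the exponent n - 1, so that n = 0 is covered too. *)
Lemma derXnM x n : delta (x ^+ n) * x = n%:R * x ^+ n * delta x.
Proof.
case: n => [|n]; first by rewrite expr0 der1 !mul0r.
by rewrite derXn exprS; ring.
Qed.

(* From a^(n+1) d^m in Q, with d = delta a, differentiating and multiplying
   by d gives (n+1) a^n d^(m+2) in Q. *)
Lemma der_nilpotent Q a n : is_ideal Q -> der_stable Q ->
  Q (a ^+ n) -> exists m, Q (delta a ^+ m).
Proof.
move=> hQ dQ; rewrite -[a ^+ n]mulr1 -(expr0 (delta a)).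
elim: n 0%N => [|n IHn] m; first by rewrite mul1r; exists m.
set d := delta a => Qm; apply: (IHn m.+2); apply: (@natr_unit_ideal _ n) => //.
have -> : n.+1%:R * (a ^+ n * d ^+ m.+2) = delta (a ^+ n.+1 * d ^+ m) * d -
    (m%:R * delta d) * (a ^+ n.+1 * d ^+ m).
  rewrite der_leibniz mulrDl -(mulrA _ (delta (d ^+ m))) derXnM derXn -/d.
  by rewrite !exprS; ring.
by apply: idealB => //; [apply: Defs.idealMr => //; apply: dQ|apply: idealMl].
Qed.

Definition der_prime Q : Prop :=
  forall I J, is_ideal I -> der_stable I -> is_ideal J -> der_stable J ->
    (forall x y, I x -> J y -> Q (x * y)) -> I `<=` Q \/ J `<=` Q.

Section Prime.
Variable Q : set A.
Hypotheses (hQ : is_ideal Q) (dQ : der_stable Q) (pQ : der_prime Q).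

(** Primeness is applied to the annihilator I, modulo Q, of all iterated derivatives of b, and to
    the annihilator J of I modulo Q. The Leibniz rule makes both stable; a lies in I by hypothesis,
    and b lies in J by the case i = 0. *)
Let der_prime_orbit a b :
  (forall i, Q (a * iter i delta b)) -> Q a \/ Q b.
Proof.
move=> Qab; pose I : set A := [set x | forall i, Q (x * iter i delta b)].
have hI : is_ideal I.
  split=> [i|x y Ix Iy i|c x Ix i|c x Ix i].
  - by rewrite mul0r; apply: ideal0.
  - by rewrite mulrDl; apply: idealD.
  - by rewrite -mulrA; apply: idealMl.
  - by rewrite mulrAC; apply: Defs.idealMr.
have dI : der_stable I.
  move=> x Ix i; have -> : delta x * iter i delta b =
    delta (x * iter i delta b) - x * iter i.+1 delta b.
    by rewrite der_leibniz /= addrK.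
  by apply: idealB => //; apply: dQ.
pose J : set A := [set y | forall x, I x -> Q (x * y)].
have hJ : is_ideal J.
  split=> [x Ix|y z Jy Jz x Ix|c y Jy x Ix|c y Jy x Ix].
  - by rewrite mulr0; apply: ideal0.
  - by rewrite mulrDr; apply: idealD => //; [apply: Jy|apply: Jz].
  - by rewrite mulrCA; apply: idealMl => //; apply: Jy.
  - by rewrite mulrA; apply: Defs.idealMr => //; apply: Jy.
have dJ : der_stable J.
  move=> y Jy x Ix; have -> : x * delta y = delta (x * y) - delta x * y.
    by rewrite der_leibniz addrAC subrr add0r.
  by apply: idealB => //; [apply: dQ; apply: Jy|apply: Jy; apply: dI].
have [IQ|JQ] := pQ hI dI hJ dJ (fun x y Ix Jy => Jy x Ix).
  by left; apply: IQ.
by right; apply: JQ => x Ix; apply: (Ix 0%N).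
Qed.

(** Take for c the last power of x whose product with b is outside Q. *)
Let annihilate_nilpotent b x n : ~ Q b -> Q (x ^+ n) ->
  exists c, ~ Q (b * c) /\ Q (b * c * x).
Proof.
move=> Qb /(idealMl hQ b); elim: n => [|n IHn]; first by rewrite mulr1.
rewrite exprSr mulrA => Qbxx.
by have [/IHn|Qbx] := pselect (Q (b * x ^+ n)); last exists (x ^+ n).
Qed.

Hypothesis noethA : noetherian A.

(** Every iterated derivative of a is nilpotent modulo Q, so any finite number of them has a common
    annihilator outside Q. By the Noetherian hypothesis finitely many generate all the others, and
    [der_prime_orbit] concludes. *)
Let radical a n : Q (a ^+ n) -> Q a.
Proof.
move=> Qan; have Qn i : exists m, Q (iter i delta a ^+ m).
  elim: i => [|i [m Qm]]; first by exists n.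
  exact: der_nilpotent Qm.
(* [der_prime] allows Q to be the whole ring, whereas the multipliers built below start from 1
   outside Q. *)
have [Q1|Q1] := pselect (Q 1); first by rewrite -[a]mulr1; apply: idealMl.
have ann N : exists b, ~ Q b /\ forall i, (i < N)%N -> Q (b * iter i delta a).
  elim: N => [|N [b [Qb annb]]]; first by exists 1.
  have [m /(annihilate_nilpotent Qb) [c [Qbc Qbca]]] := Qn N.
  exists (b * c); split=> // i; rewrite ltnS leq_eqVlt => /predU1P[->//|iN].
  by rewrite mulrAC; apply: Defs.idealMr => //; apply: annb.
pose S N : set A := [set x | exists2 i, (i <= N)%N & x = iter i delta a].
have [|M SM] := noethA (fun N => is_ideal_gen (S N)).
  move=> N; apply: ideal_gen_sub; first exact: is_ideal_gen.
  by move=> _ [i iN ->]; apply: sub_ideal_gen; exists i => //; apply: leqW.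
have [b [Qb annb]] := ann M.+1.
have [i|//|//] := @der_prime_orbit b a.
(* The chain is constant from M on, so the index [maxn M i] places the i-th derivative in the ideal
   generated by the first M + 1; that ideal is annihilated by b modulo Q. *)
have : ideal_gen (S M) (iter i delta a).
  rewrite -(SM (maxn M i)) ?leq_maxl //; apply: sub_ideal_gen.
  by exists i => //; apply: leq_maxr.
move=> /(_ [set x | Q (b * x)]); apply.
  split=> [|x y Qx Qy|c x Qx|c x Qx] /=.
  - by rewrite mulr0; apply: ideal0.
  - by rewrite mulrDr; apply: idealD.
  - by rewrite mulrCA; apply: idealMl.
  - by rewrite mulrA; apply: Defs.idealMr.
by move=> _ [j jM ->]; apply: annb.
Qed.

(** By induction a multiplies every iterated derivative of b into Q: if a c is in Q, then so is the
    square of a times the derivative of c, and Q is radical. *)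
Lemma der_prime_prime a b : Q (a * b) -> Q a \/ Q b.
Proof.
move=> Qab; apply: der_prime_orbit; elim=> //= i.
set c := iter i delta b => Qac.
apply: (@radical _ 2).
have -> : (a * delta c) ^+ 2 =
    a * delta c * delta (a * c) - delta a * delta c * (a * c).
  by rewrite der_leibniz; ring.
by apply: idealB => //; apply: idealMl => //; apply: dQ.
Qed.

End Prime.
End DeltaPrime.

(** * A common framework for the two structures on [{poly A}] *)

Section PolynomialModels.
Local Open Scope classical_set_scope.
Context {k : numFieldType} {A : comAlgType k} (delta : derivation A).
Implicit Types (Q : set A) (I J P : set {poly A}) (p q : {poly A}) (a b c : A).

Definition coef_set Q : set {poly A} := [set p | forall i, Q p`_i].
Definition const_set P : set A := [set a | P a%:P].

Lemma is_ideal_coef_set Q : is_ideal Q -> is_ideal (coef_set Q).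
Proof.
move=> hQ; split=> [i|p q Qp Qq i|p q Qq i|p q Qq i].
- by rewrite coef0; apply: ideal0.
- by rewrite coefD; apply: idealD.
- by rewrite coefM; apply: ideal_sum => // j; apply: idealMl.
- by rewrite coefM; apply: ideal_sum => // j; apply: Defs.idealMr.
Qed.

Lemma is_ideal_const_set P : is_ideal P -> is_ideal (const_set P).
Proof.
move=> hP; rewrite /const_set; split=> [|a b|a b|a b] /=.
- by rewrite polyC0; apply: ideal0.
- by rewrite polyCD; apply: idealD.
- by rewrite polyCM; apply: idealMl.
- by rewrite polyCM; apply: Defs.idealMr.
Qed.

Lemma coef_set_const_sub P : is_ideal P -> coef_set (const_set P) `<=` P.
Proof.
move=> hP p Pp; rewrite -[p]coefK poly_def; apply: ideal_sum => // i.
by rewrite -mul_polyC; apply: Defs.idealMr => //; apply: Pp.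
Qed.

Lemma coef_setC Q a : Q 0 -> coef_set Q a%:P <-> Q a.
Proof.
move=> Q0; split=> [/(_ 0%N)|Qa i]; rewrite coefC ?eqxx //.
by case: eqP.
Qed.

(* ad-closed ideals stand for the two-sided ideals of A[z; delta] when
   [ad c p = p c - c p], and for the Poisson ideals of A[z] when
   [ad c p = {p, c}]; in both cases [z, p], resp. {z, p}, is [der_coef p]. *)
Record ad_ideal (ad : A -> {poly A} -> {poly A}) I : Prop := AdIdeal {
  ad_ideal_ideal :> is_ideal I;
  ad_ideal_der : forall p, I p -> I (der_coef delta p);
  ad_ideal_ad : forall c p, I p -> I (ad c p) }.

(** An interface to both products, with the commutator or bracket that goes with each, so that the
    primes are classified only once. *)
Record poly_model := PolyModel {
  pm_mul : {poly A} -> {poly A} -> {poly A};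
  pm_ad : A -> {poly A} -> {poly A};
  pm_mulDl : forall p q r, pm_mul (p + q) r = pm_mul p r + pm_mul q r;
  pm_mulDr : forall p q r, pm_mul p (q + r) = pm_mul p q + pm_mul p r;
  pm_mulC : forall a b, pm_mul a%:P b%:P = (a * b)%:P;
  pm_idealMl : forall I p q, ad_ideal pm_ad I -> I q -> I (pm_mul p q);
  pm_idealMr : forall I p q, ad_ideal pm_ad I -> I p -> I (pm_mul p q);
  pm_mul_coef : forall Q1 Q2 Q p q, is_ideal Q2 -> der_stable delta Q2 ->
    is_ideal Q -> (forall x y, Q1 x -> Q2 y -> Q (x * y)) ->
    coef_set Q1 p -> coef_set Q2 q -> coef_set Q (pm_mul p q);
  pm_mul_mod : forall Q p q, is_ideal Q -> (forall a, Q (delta a)) ->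
    coef_set Q (pm_mul p q - p * q);
  pm_adD : forall c p q, pm_ad c (p + q) = pm_ad c p + pm_ad c q;
  pm_ad_coef : forall Q c p, is_ideal Q ->
    coef_set Q p -> coef_set Q (pm_ad c p);
  pm_ad_mod : forall Q c p, is_ideal Q -> (forall a, Q (delta a)) ->
    coef_set Q (pm_ad c p);
  pm_ad_lead : forall c p n, (size p <= n.+2)%N ->
    (size (pm_ad c p) <= n.+1)%N /\
    (pm_ad c p)`_n = n.+1%:R * (p`_n.+1 * delta c) }.

Definition pm_prime (m : poly_model) P : Prop :=
  [/\ ad_ideal (pm_ad m) P, P <> setT &
    forall I J, ad_ideal (pm_ad m) I -> ad_ideal (pm_ad m) J ->
    (forall x y, I x -> J y -> P (pm_mul m x y)) -> I `<=` P \/ J `<=` P].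

(** Neither this condition nor [extended_type] mentions a model, which is what allows the primes of
    two models to be compared as subsets. *)
Definition commutative_type P : Prop :=
  prime_ideal P /\ forall a, P (delta a)%:P.

Definition extended_type P : Prop := exists Q,
  [/\ is_ideal Q, der_stable delta Q, ~ Q 1 /\ exists c, ~ Q (delta c),
      forall a b, Q (a * b) -> Q a \/ Q b & P = coef_set Q].

(** * Classification of the primes of a model *)

Section Model.
Variable m : poly_model.
Local Notation ad := (pm_ad m).
Local Notation mul := (pm_mul m).

Lemma ad_ideal_coef_set Q :
  is_ideal Q -> der_stable delta Q -> ad_ideal ad (coef_set Q).
Proof.
move=> hQ dQ; split; first exact: is_ideal_coef_set.
  by move=> p Qp i; rewrite coef_der_coef; apply: dQ.
by move=> c p; apply: pm_ad_coef.
Qed.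

Lemma ad_ideal_add I J :
  ad_ideal ad I -> ad_ideal ad J -> ad_ideal ad (ideal_add I J).
Proof.
move=> hI hJ; split=> [|p [u Iu Jp]|c p [u Iu Jp]].
- exact: is_ideal_add hI hJ.
- exists (der_coef delta u); first exact: (ad_ideal_der hI Iu).
  by rewrite /der_coef -raddfB; apply: (ad_ideal_der hJ Jp).
- exists (ad c u); first exact: (ad_ideal_ad hI _ Iu).
  have -> : ad c p - ad c u = ad c (p - u).
    by apply/eqP; rewrite subr_eq -pm_adD subrK.
  exact: (ad_ideal_ad hJ _ Jp).
Qed.

(** All coefficients of [der_coef delta p] and of [ad c p] lie in the contraction of I to A, because
    it contains the image of [delta]. *)
Lemma ad_ideal_commutative I :
  is_ideal I -> (forall a, I (delta a)%:P) -> ad_ideal ad I.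
Proof.
move=> hI dI; have hC := is_ideal_const_set hI; split=> // [p _|c p _].
  by apply: coef_set_const_sub => // i; rewrite coef_der_coef; apply: dI.
by apply: coef_set_const_sub => //; apply: pm_ad_mod.
Qed.

(** Replacing I and J by I + P and J + P keeps them ad-closed and keeps their products in P. *)
Lemma pm_prime_over P : ad_ideal ad P -> P <> setT ->
  (forall I J, ad_ideal ad I -> ad_ideal ad J -> P `<=` I -> P `<=` J ->
    (forall x y, I x -> J y -> P (mul x y)) -> I `<=` P \/ J `<=` P) ->
  pm_prime m P.
Proof.
move=> hP PT primeP; split=> // I J hI hJ IJP.
have [] := primeP (ideal_add I P) (ideal_add J P).
- exact: ad_ideal_add.
- exact: ad_ideal_add.
- exact: sub_ideal_addr hI.
- exact: sub_ideal_addr hJ.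
- move=> x y [u Iu Px] [v Jv Py]; rewrite -[x](subrK u) -[y](subrK v) pm_mulDl.
  rewrite (pm_mulDr _ u); apply: (idealD hP); first exact: pm_idealMr.
  by apply: (idealD hP); [apply: pm_idealMl|apply: IJP].
- by left; apply: ideal_add_sub hP _.
- by right; apply: ideal_add_sub hP _.
Qed.

(* Commuting with c lowers the degree by one and multiplies the leading
   coefficient by n * delta c, which is regular modulo Q. *)
Lemma ad_ideal_const Q I c p : is_ideal Q -> ~ Q (delta c) ->
  (forall a b, Q (a * b) -> Q a \/ Q b) -> ad_ideal ad I ->
  coef_set Q `<=` I -> I p -> ~ coef_set Q p -> exists2 a, I a%:P & ~ Q a.
Proof.
move=> hQ Qc primeQ hI QI.
(* Induction on a degree bound n; for n = 0 the polynomial is a constant. *)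
have : (size p <= (size p).+1)%N by []; move: {2}(size p) => n.
elim: n p => [|n IHn] p le_pn Ip Qp.
  exists p`_0; first by rewrite -size1_polyC.
  by move/(coef_setC _ (ideal0 hQ)); rewrite -size1_polyC.
(* A top coefficient in Q is removed by subtracting its monomial, which lies in [coef_set Q] and
   hence in I. *)
have [Qpn|Qpn] := pselect (Q p`_n.+1).
  have Qq : coef_set Q (p`_n.+1 *: 'X^(n.+1)).
    move=> i; rewrite coefZ coefXn; case: eqP; rewrite ?mulr1 ?mulr0 // => _.
    exact: ideal0.
  apply: (IHn (p - p`_n.+1 *: 'X^(n.+1))).
  - apply/leq_sizeP => i; rewrite leq_eqVlt => /predU1P[<-|lt_ni].
      by rewrite coefB coefZ coefXn eqxx mulr1 subrr.
    rewrite coefB coefZ coefXn gtn_eqF // mulr0 subr0 nth_default //.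
    exact: leq_trans le_pn lt_ni.
  - by apply: (idealB hI) => //; apply: QI.
  - move=> /(idealD (is_ideal_coef_set hQ))/(_ Qq).
    by rewrite subrK.
have [le_an an] := pm_ad_lead m c le_pn.
apply: (IHn _ le_an (ad_ideal_ad hI c Ip)); move=> Qa; have := Qa n; rewrite an.
by move=> /(natr_unit_ideal hQ)/primeQ[].
Qed.

(** The contraction Q of P inherits derivation-primeness through [coef_set], hence is prime. An
    element of P outside Q[z] would produce, by [ad_ideal_const], a constant of P outside Q. *)
Lemma pm_prime_extended P : noetherian A -> pm_prime m P ->
  ~ (forall a, P (delta a)%:P) -> extended_type P.
Proof.
move=> noethA [hP PT primeP] nP; set Q := const_set P.
have hQ : is_ideal Q := is_ideal_const_set hP.
have dQ : der_stable delta Q.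
  move=> a Qa; rewrite /Q /const_set /= -der_coefC.
  exact: (ad_ideal_der hP Qa).
have QP : coef_set Q `<=` P := coef_set_const_sub hP.
have Q1 : ~ Q 1.
  move=> P1; apply: PT; apply/seteqP; split=> // p _.
  by rewrite -[p]mulr1; apply: (idealMl hP).
have [c Qc] : exists c, ~ Q (delta c) by apply/existsNP.
have primeQ : forall a b, Q (a * b) -> Q a \/ Q b.
  move=> a b; apply: (@der_prime_prime _ _ delta) => // I J hI dI hJ dJ IJQ.
  have [| | |IP|JP] := primeP (coef_set I) (coef_set J).
  - exact: ad_ideal_coef_set.
  - exact: ad_ideal_coef_set.
  - by move=> x y Ix Jy; apply: QP; apply: pm_mul_coef IJQ Ix Jy.
  - by left=> x Ix; apply: IP; apply/coef_setC => //; apply: ideal0.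
  - by right=> x Jx; apply: JP; apply/coef_setC => //; apply: ideal0.
exists Q; split=> //; first by split=> //; exists c.
apply/seteqP; split=> // p Pp; apply: contrapT => Qp.
by have [a Pa []] := ad_ideal_const hQ Qc primeQ hP QP Pp Qp.
Qed.

Lemma pm_primeP P : noetherian A ->
  pm_prime m P <-> commutative_type P \/ extended_type P.
Proof.
move=> noethA; split=> [primeP|].
  have [dP|] := pselect (forall a, P (delta a)%:P); last first.
    by right; apply: pm_prime_extended.
  have [/ad_ideal_ideal hP PT IJP] := primeP; left; split=> //; split=> //.
  move=> I J hI hJ /(ideal_mul_subP _ _ hP) IJ.
  (* Here I and J are only ordinary ideals; adding P puts the image of [delta] into them and so
     makes them ad-closed. *)
  have [] := IJP (ideal_add I P) (ideal_add J P).
  - apply: ad_ideal_commutative; first exact: is_ideal_add.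
    by move=> a; apply: sub_ideal_addr.
  - apply: ad_ideal_commutative; first exact: is_ideal_add.
    by move=> a; apply: sub_ideal_addr.
  (* Modulo P the product of the model is the ordinary one. *)
  - move=> x y [u Iu Px] [v Jv Py]; rewrite -[mul x y](subrK (x * y)).
    apply: (idealD hP).
      apply: coef_set_const_sub => //; apply: pm_mul_mod => //.
      exact: is_ideal_const_set.
    rewrite -{1}[x](subrK u) -[y](subrK v) mulrDl (mulrDr u).
    apply: (idealD hP); first exact: (Defs.idealMr hP).
    by apply: (idealD hP); [apply: (idealMl hP)|apply: IJ].
  - by left; apply: ideal_add_sub.
  - by right; apply: ideal_add_sub.
case=> [[primeP dP]|[Q [hQ dQ [Q1 [c Qc]] primeQ ->]]].
  have hP := prime_is_ideal primeP; apply: pm_prime_over.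
  - exact: ad_ideal_commutative.
  - exact: prime_proper primeP.
  move=> I J hI hJ PI PJ IJP; apply: (primeM primeP hI hJ).
  apply/(ideal_mul_subP _ _ hP) => x y Ix Jy; rewrite -[x * y](subKr (mul x y)).
  apply: idealB => //; first exact: IJP.
  apply: coef_set_const_sub => //; apply: pm_mul_mod => //.
  exact: is_ideal_const_set.
apply: pm_prime_over.
- exact: ad_ideal_coef_set.
- move=> QT; apply: Q1; apply/(coef_setC _ (ideal0 hQ)).
  by rewrite QT.
(* Otherwise I and J contain constants a and b outside Q; their product in the model is the constant
   a b, against the primeness of Q. *)
move=> I J hI hJ QI QJ IJQ; apply: contrapT => /not_orP[IQ JQ].
have [x Ix Qx] : exists2 x, I x & ~ coef_set Q x by apply/existsPNP.
have [y Jy Qy] : exists2 x, J x & ~ coef_set Q x by apply/existsPNP.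
have [a Ia Qa] := ad_ideal_const hQ Qc primeQ hI QI Ix Qx.
have [b Jb Qb] := ad_ideal_const hQ Qc primeQ hJ QJ Jy Qy.
have := IJQ _ _ Ia Jb; rewrite pm_mulC.
by move/(coef_setC _ (ideal0 hQ))/primeQ => [].
Qed.

End Model.
End PolynomialModels.

(** * The Ore extension as a model *)

Section OreModel.
Local Open Scope classical_set_scope.
Context {k : numFieldType} {A : comAlgType k} (delta : derivation A).
Implicit Types (Q : set A) (p q r : {poly A}) (a b c : A).
Local Notation zmul := (ore_zmul delta).
Local Notation mul := (ore_mul delta).

Lemma der_coefXn n : der_coef delta 'X^n = 0.
Proof.
elim: n => [|n IHn]; first by rewrite expr0 der_coefC der1.
by rewrite exprS der_coefM der_coefX IHn mul0r mulr0 addr0.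
Qed.

Lemma iter_zmulX i : iter i zmul 'X = 'X^(i.+1).
Proof.
elim: i => [|i IHi]; first by rewrite expr1.
by rewrite iterS IHi /ore_zmul der_coefXn addr0 -exprSr.
Qed.

Lemma ore_mulE n p q : (size p <= n)%N ->
  mul p q = \sum_(i < n) p`_i *: iter i zmul q.
Proof.
move=> le_pn; rewrite /ore_mul.
rewrite (big_ord_widen n (fun i => p`_i *: iter i zmul q)) //.
rewrite big_mkcond; apply: eq_bigr => i _ /=; case: ltnP => // le_pi.
by rewrite nth_default // scale0r.
Qed.

Lemma ore_mulCl a q : mul a%:P q = a *: q.
Proof. by rewrite (@ore_mulE 1) ?size_polyC ?leq_b1 // big_ord1 coefC. Qed.

Lemma ore_mulXl q : mul 'X q = zmul q.
Proof.
rewrite (@ore_mulE 2) ?size_polyX // big_ord_recl big_ord1 /= !coefX /=.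
by rewrite scale0r add0r scale1r.
Qed.

Lemma ore_mulXr p : mul p 'X = p * 'X.
Proof.
rewrite -[p in RHS]coefK poly_def mulr_suml; apply: eq_bigr => i _.
by rewrite iter_zmulX -scalerAl -exprSr.
Qed.

Lemma ore_mulDl p q r : mul (p + q) r = mul p r + mul q r.
Proof. exact: (@mulrDl (ore_ext delta)). Qed.

Lemma ore_mulDr p q r : mul p (q + r) = mul p q + mul p r.
Proof. exact: (@mulrDr (ore_ext delta)). Qed.

Lemma ore_mulA p q r : mul p (mul q r) = mul (mul p q) r.
Proof. exact: (@mulrA (ore_ext delta)). Qed.

Definition ore_ad c p : {poly A} := mul p c%:P - mul c%:P p.

(* z^i c - c z^i *)
Let adX c i : {poly A} := iter i zmul c%:P - c *: 'X^i.

(** Left multiplication by z is [ore_zmul]; applied to the monomial c z^i it leaves the correction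
    term [delta c *: 'X^i]. Each step thus contributes one more [delta c] to the top coefficient,
    whence the factor in [adX_lead]. *)
Let adXS c i : adX c i.+1 = adX c i * 'X + der_coef delta (adX c i)
  + delta c *: 'X^i.
Proof.
rewrite /adX iterS; set w := iter i zmul c%:P; rewrite /ore_zmul exprSr.
have -> : der_coef delta (w - c *: 'X^i) = der_coef delta w - delta c *: 'X^i.
  rewrite /der_coef raddfB /= -!/(der_coef _ _).
  by rewrite der_coefZ der_coefXn scaler0 addr0.
by rewrite -!mul_polyC; ring.
Qed.

Let adX_coef c i j : (i <= j)%N -> (adX c i)`_j = 0.
Proof.
elim: i j => [|i IHi] [|j] // le_ij.
- by rewrite /adX /= expr0 alg_polyC subrr coef0.
- by rewrite /adX /= expr0 alg_polyC subrr coef0.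
rewrite adXS !coefD coefMX /= coef_der_coef coefZ coefXn.
rewrite !IHi //; last exact: ltnW.
by rewrite raddf0 gtn_eqF // mulr0 !addr0.
Qed.

Let adX_lead c i : (adX c i.+1)`_i = i.+1%:R * delta c.
Proof.
elim: i => [|i IHi]; rewrite adXS !coefD coefMX /= coef_der_coef coefZ;
  rewrite coefXn eqxx.
  by rewrite adX_coef // raddf0 !add0r mulr1 mul1r.
by rewrite IHi adX_coef // raddf0 addr0 mulr1 -[in RHS]natr1 mulrDl mul1r.
Qed.

Let iter_zmul_mod Q p i : is_ideal Q -> (forall a, Q (delta a)) ->
  coef_set Q (iter i zmul p - p * 'X^i).
Proof.
move=> hQ Qd; have hQX := is_ideal_coef_set hQ.
elim: i => [|i IHi]; first by rewrite expr0 mulr1 subrr; apply: ideal0.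
rewrite iterS /ore_zmul exprSr mulrA addrAC -mulrBl; apply: (idealD hQX).
  exact: (Defs.idealMr hQX).
by move=> j; rewrite coef_der_coef.
Qed.

Let ore_adE c p n : (size p <= n)%N ->
  ore_ad c p = \sum_(i < n) p`_i *: adX c i.
Proof.
move=> le_pn; rewrite /ore_ad ore_mulCl (ore_mulE _ le_pn).
have {2}-> : p = \sum_(i < n) p`_i *: 'X^i.
  rewrite -poly_def; apply/polyP => i; rewrite coef_poly.
  by case: ltnP => // le_ni; rewrite nth_default // (leq_trans le_pn).
rewrite scaler_sumr -sumrB; apply: eq_bigr => i _.
by rewrite /adX scalerBr !scalerA (mulrC c).
Qed.

Let ore_adE_size c p : ore_ad c p = \sum_(i < size p) p`_i *: adX c i.
Proof. exact: ore_adE. Qed.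

Lemma ore_adD c p q : ore_ad c (p + q) = ore_ad c p + ore_ad c q.
Proof. by rewrite /ore_ad ore_mulDl ore_mulDr opprD addrACA. Qed.

Lemma ore_ad_coef Q c p : is_ideal Q -> coef_set Q p -> coef_set Q (ore_ad c p).
Proof.
move=> hQ Qp j; rewrite ore_adE_size coef_sum; apply: ideal_sum => // i.
by rewrite coefZ; apply: Defs.idealMr.
Qed.

Lemma ore_ad_mod Q c p : is_ideal Q -> (forall a, Q (delta a)) ->
  coef_set Q (ore_ad c p).
Proof.
move=> hQ Qd j; rewrite ore_adE_size coef_sum; apply: ideal_sum => // i.
rewrite coefZ; apply: idealMl => //; rewrite /adX -mul_polyC.
exact: iter_zmul_mod.
Qed.

Lemma ore_ad_lead c p n : (size p <= n.+2)%N ->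
  (size (ore_ad c p) <= n.+1)%N /\
  (ore_ad c p)`_n = n.+1%:R * (p`_n.+1 * delta c).
Proof.
move=> /(ore_adE c) ->; split.
  apply/leq_sizeP => j lt_nj; rewrite coef_sum big1 // => i _.
  by rewrite coefZ adX_coef ?mulr0 // (leq_trans _ lt_nj) // -ltnS.
rewrite coef_sum big_ord_recr /= big1 => [|i _].
  by rewrite add0r coefZ adX_lead mulrCA.
by rewrite coefZ adX_coef ?mulr0 // -ltnS.
Qed.

Lemma ore_mul_coef Q1 Q2 Q p q : is_ideal Q2 -> der_stable delta Q2 ->
  is_ideal Q -> (forall x y, Q1 x -> Q2 y -> Q (x * y)) ->
  coef_set Q1 p -> coef_set Q2 q -> coef_set Q (mul p q).
Proof.
move=> hQ2 dQ2 hQ Q12 Qp Qq j; rewrite coef_sum; apply: ideal_sum => // i.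
rewrite coefZ; apply: Q12 => //; elim: (i : nat) j => //= {}i IHi j.
rewrite coefD coef_der_coef; apply: idealD => //; last exact: dQ2.
by rewrite coefMX; case: ifP => // _; apply: ideal0.
Qed.

Lemma ore_mul_mod Q p q : is_ideal Q -> (forall a, Q (delta a)) ->
  coef_set Q (mul p q - p * q).
Proof.
move=> hQ Qd; rewrite -[p in p * q]coefK poly_def mulr_suml -sumrB.
apply: ideal_sum => [|i]; first exact: is_ideal_coef_set.
have -> : p`_i *: iter i zmul q - (p`_i *: 'X^i) * q =
    (p`_i)%:P * (iter i zmul q - q * 'X^i).
  by rewrite mulrBr !mul_polyC -scalerAl (mulrC q).
by apply: (idealMl (is_ideal_coef_set hQ)); apply: iter_zmul_mod.
Qed.

(** Right multiplication by z and left multiplication by constants are the same in [A[z; delta]] and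
    in [A[z]]. The remaining one-sided products differ from these by [der_coef] and by [ore_ad]. *)
Lemma ore_idealP (I : set {poly A}) :
  is_ideal (I : set (ore_ext delta)) <-> ad_ideal delta ore_ad I.
Proof.
split=> hI.
  have IM p q : I q -> I (mul p q) by apply: (idealMl hI).
  have IMr p q : I p -> I (mul p q) by apply: (Defs.idealMr hI).
  have IB p q : I p -> I q -> I (p - q) by apply: (idealB hI).
  have ID p q : I p -> I q -> I (p + q) by apply: (idealD hI).
  have I0 : I 0 by apply: (ideal0 hI).
  (* The ordinary product is rebuilt from the Ore operations common to both rings, by induction on
     p. *)
  have IMc p q : I q -> I (p * q).
    elim/poly_ind: p q => [|p c IHp] q Iq; first by rewrite mul0r.
    rewrite mulrDl -mulrA mul_polyC -ore_mulCl (mulrC _ q) -ore_mulXr.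
    by apply: ID; [apply: IHp; apply: IMr|apply: IM].
  split=> [|p Ip|c p Ip].
  - by split=> // a x Ix; rewrite mulrC; apply: IMc.
  - have -> : der_coef delta p = mul 'X p - p * 'X.
      by rewrite ore_mulXl /ore_zmul addrAC subrr add0r.
    by rewrite -ore_mulXr; apply: IB; [apply: IM|apply: IMr].
  - by apply: IB; [apply: IMr|apply: IM].
have hI' : is_ideal I := hI.
have IZ a p : I p -> I (a *: p) by rewrite -mul_polyC; apply: (idealMl hI').
split.
- exact: (ideal0 hI').
- exact: (idealD hI').
- move=> p q Iq; apply: (ideal_sum _ hI') => i; apply: IZ.
  elim: (i : nat) => //= {}i IHi; apply: (idealD hI').
    exact: (Defs.idealMr hI').
  exact: (ad_ideal_der hI).
have IC c p : I p -> I (mul p c%:P).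
  move=> Ip; rewrite -[mul p _](subrK (mul c%:P p)); apply: (idealD hI').
    exact: (ad_ideal_ad hI).
  by rewrite ore_mulCl; apply: IZ.
move=> q p Ip; have -> : (p : ore_ext delta) * q = mul p q by [].
(* A right factor r z + c acts through r, then z, plus c; only the constant needs closure under
   [ore_ad]. *)
elim/poly_ind: (q : {poly A}) => [|r c IHr].
  by rewrite -polyC0; apply: IC.
rewrite -ore_mulXr ore_mulDr ore_mulA ore_mulXr; apply: (idealD hI').
  exact: (Defs.idealMr hI').
exact: IC.
Qed.

Definition ore_model : poly_model delta.
Proof.
refine (@PolyModel _ _ _ mul ore_ad ore_mulDl ore_mulDr _ _ _
  ore_mul_coef ore_mul_mod ore_adD ore_ad_coef ore_ad_mod ore_ad_lead).
- by move=> a b; rewrite ore_mulCl -mul_polyC -polyCM.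
- by move=> I p q /ore_idealP hI; apply: (idealMl hI).
- by move=> I p q /ore_idealP hI; apply: (Defs.idealMr hI).
Defined.

Lemma ore_primeP (P : set {poly A}) :
  prime_ideal (P : set (ore_ext delta)) <-> pm_prime ore_model P.
Proof.
split=> [[hP PT primeP]|[/ore_idealP hP PT primeP]].
  split=> // [|I J /ore_idealP hI /ore_idealP hJ IJP]; first exact/ore_idealP.
  by apply: (primeP I J hI hJ); apply/(ideal_mul_subP _ _ hP).
split=> // I J hI hJ /(ideal_mul_subP _ _ hP) IJP.
by apply: primeP => //; apply/ore_idealP.
Qed.

End OreModel.

(** * The Poisson algebra as a model *)

Section PoissonModel.
Local Open Scope classical_set_scope.
Context {k : numFieldType} {A : comAlgType k} (delta : derivation A).
Implicit Types (Q : set A) (p q r : {poly A}) (a b c : A).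

Definition poisson_ad c p : {poly A} := p^`() * (delta c)%:P.

(** Brackets with z and with constants give the two closure conditions. Conversely, expanding
    [der_coef delta q] into monomials writes the first term of the bracket as a combination of
    values of [poisson_ad]. *)
Lemma poisson_idealP (I : set {poly A}) :
  poisson_ideal (I : set (poisson_poly delta)) <-> ad_ideal delta poisson_ad I.
Proof.
split=> [[hI brI]|hI].
  have hI' : is_ideal I := hI; split=> // [p Ip|c p Ip].
    have := brI p ('X : {poly A}) Ip; rewrite /bracket /= /ppoly_bracket.
    rewrite der_coefX mulr0 sub0r derivX mulr1 => /(idealN hI').
    by rewrite opprK.
  have := brI p (c%:P : {poly A}) Ip; rewrite /bracket /= /ppoly_bracket.
  by rewrite der_coefC derivC mulr0 subr0.
have hI' : is_ideal I := hI; split=> // p q Ip.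
rewrite /bracket /= /ppoly_bracket; apply: (idealB hI'); last first.
  by apply: (Defs.idealMr hI'); apply: (ad_ideal_der hI).
rewrite -[der_coef delta q]coefK poly_def mulr_sumr.
apply: (ideal_sum _ hI') => i.
rewrite coef_der_coef -mul_polyC mulrA; apply: (Defs.idealMr hI').
exact: (ad_ideal_ad hI).
Qed.

Definition poisson_model : poly_model delta.
Proof.
refine (@PolyModel _ _ _ (fun p q => p * q) poisson_ad _ _ _ _ _ _ _ _ _ _ _).
- exact: mulrDl.
- exact: mulrDr.
- by move=> a b; rewrite polyCM.
- by move=> I p q hI; apply: (idealMl hI).
- by move=> I p q hI; apply: (Defs.idealMr hI).
- move=> Q1 Q2 Q p q _ _ hQ Q12 Qp Qq j; rewrite coefM.
  by apply: ideal_sum => // i; apply: Q12.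
- by move=> Q p q hQ _; rewrite subrr; apply: (ideal0 (is_ideal_coef_set hQ)).
- by move=> c p q; rewrite /poisson_ad derivD mulrDl.
- move=> Q c p hQ Qp; apply: (Defs.idealMr (is_ideal_coef_set hQ)).
  by move=> i; rewrite coef_deriv -mulr_natl; apply: idealMl.
- move=> Q c p hQ Qd; apply: (idealMl (is_ideal_coef_set hQ)).
  by apply/coef_setC => //; apply: ideal0.
- move=> c p n le_pn; rewrite /poisson_ad; split.
    rewrite mulrC mul_polyC; apply: (leq_trans (size_scale_leq _ _)).
    apply/leq_sizeP => j lt_nj.
    by rewrite coef_deriv nth_default ?mul0rn // (leq_trans le_pn).
  by rewrite coefMC coef_deriv mulrA mulr_natl.
Defined.

Lemma poisson_primeP (P : set {poly A}) :
  poisson_prime (P : set (poisson_poly delta)) <-> pm_prime poisson_model P.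
Proof.
split=> [[/poisson_idealP hP PT primeP]|[hP PT primeP]].
  split=> // I J hI hJ IJP.
  apply: (primeP I J); try exact/poisson_idealP.
  by apply/(ideal_mul_subP _ _ (ad_ideal_ideal hP)).
have hP' := ad_ideal_ideal hP.
split=> [|//|I J /poisson_idealP hI /poisson_idealP hJ].
  exact/poisson_idealP.
by move=> /(ideal_mul_subP _ _ hP') IJP; apply: primeP.
Qed.

End PoissonModel.

(** * Identification of the two spectra *)

Section Homeomorphism.
Local Open Scope classical_set_scope.
Context {k : numFieldType} {A : comAlgType k} (delta : derivation A).
Hypothesis noethA : noetherian A.

(** Both sides reduce to the same model-free classification. *)
Lemma ore_poisson_prime (P : set {poly A}) :
  prime_ideal (P : set (ore_ext delta)) <->
  poisson_prime (P : set (poisson_poly delta)).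
Proof. by rewrite ore_primeP poisson_primeP !pm_primeP. Qed.

Definition spec_to_pspec (P : Spec (ore_ext delta)) :
    PSpec (poisson_poly delta) :=
  MkPSpec ((ore_poisson_prime P).1 (spec_prime P)).

Definition pspec_to_spec (P : PSpec (poisson_poly delta)) :
    Spec (ore_ext delta) :=
  MkSpec ((ore_poisson_prime P).2 (pspec_prime P)).

Lemma spec_to_pspecK : cancel spec_to_pspec pspec_to_spec.
Proof. by case=> P hP; congr MkSpec; apply: Prop_irrelevance. Qed.

Lemma pspec_to_specK : cancel pspec_to_spec spec_to_pspec.
Proof. by case=> P hP; congr MkPSpec; apply: Prop_irrelevance. Qed.

(** The preimage consists of the primes containing the same subset I, which may fail to be an ideal
    of the Ore extension; the ideal it generates there defines the same closed set. *)
Lemma spec_to_pspec_continuous : continuous spec_to_pspec.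
Proof.
apply/continuous_closedP => F /pspec_closedP[I hI ->].
apply/spec_closedP; exists (ideal_gen (I : set (ore_ext delta))).
  exact: is_ideal_gen.
apply/seteqP; split=> P /= IP.
  exact: ideal_gen_sub (prime_is_ideal (spec_prime P)) IP.
exact: subset_trans (@sub_ideal_gen _ _) IP.
Qed.

Lemma pspec_to_spec_continuous : continuous pspec_to_spec.
Proof.
apply/continuous_closedP => F /spec_closedP[I hI ->].
apply/pspec_closedP; exists (ideal_gen (I : set (poisson_poly delta))).
  exact: is_ideal_gen.
apply/seteqP; split=> P /= IP.
  exact: ideal_gen_sub (poisson_prime_is_ideal (pspec_prime P)).1 IP.
exact: subset_trans (@sub_ideal_gen _ _) IP.
Qed.

Lemma homeomorphic_spec_pspec :
  homeomorphic (Spec (ore_ext delta)) (PSpec (poisson_poly delta)).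
Proof.
exists spec_to_pspec, pspec_to_spec; split.
- exact: spec_to_pspecK.
- exact: pspec_to_specK.
- exact: spec_to_pspec_continuous.
- exact: pspec_to_spec_continuous.
Qed.

End Homeomorphism.

Theorem theorem3p6 (K : realType) (A : comAlgType K[i])
    (domA : forall a b : A, a * b = 0 -> a = 0 \/ b = 0)
    (noethA : noetherian A)
    (delta : derivation A) (delta_neq0 : exists a : A, delta a <> 0) :
  homeomorphic (Spec (ore_ext delta)) (PSpec (poisson_poly delta)).
Proof. exact: (@homeomorphic_spec_pspec K[i] A delta noethA). Qed.
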